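(* Let $G$ be an Abelian group, let $l,N$ be positive integers with $l\ge2$, and let $\varphi_0,\varphi_1,\ldots,\varphi_N\colon G\to\mathbb{C}$ be functions for which $$\varphi_n(x_1+x_2+\cdots+x_l)=\sum_{\substack{k_1,k_2,\ldots,k_l\ge0\\ k_1+k_2+\cdots+k_l=n}}\binom{n}{k_1,k_2,\ldots,k_l}\prod_{t=1}^{l}\varphi_{k_t}(x_t)$$ holds for all $x_1,x_2,\ldots,x_l\in G$ and $n=0,1,\ldots,N$. If $\varphi_0(0)=0$, then all the functions $\varphi_0,\varphi_1,\ldots,\varphi_N$ are identically zero. If $\varphi_0(0)=1$, then the functions $\varphi_0,\varphi_1,\ldots,\varphi_N$ form a generalized moment sequence of order $N$.
   Context: The group is written additively with neutral element $0$. For nonnegative integers $k_1,\ldots,k_l$ with $k_1+\cdots+k_l=n$, $\binom{n}{k_1,\ldots,k_l}=\frac{n!}{k_1!\cdots k_l!}$ is the multinomial coefficient. Functions $\varphi_0,\ldots,\varphi_N\colon G\to\mathbb{C}$ form a generalized moment sequence of order $N$ if $\varphi_0(0)=1$ and $$\varphi_k(x+y)=\sum_{j=0}^{k}\binom{k}{j}\varphi_j(x)\varphi_{k-j}(y)$$ for all $x,y\in G$ and $k=0,1,\ldots,N$. *)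

(* Defs.v *)
(* MathComp world; the field of complex numbers is R[i] for a realType R. *)
From mathcomp Require Import all_boot all_order all_algebra.
From mathcomp Require Import reals.
From mathcomp Require Import complex.

Set Implicit Arguments.
Unset Strict Implicit.
Unset Printing Implicit Defensive.

Import GRing.Theory.

Local Open Scope ring_scope.

(* The division is in the field F, so that it is not truncated.  Bounding the
   k_t by n loses nothing when they are nonnegative with sum n. *)
Definition multinomial (F : fieldType) (n l : nat)
    (k : {ffun 'I_l -> 'I_n.+1}) : F :=
  (n`!)%:R / \prod_(t < l) ((k t)`!)%:R.

(* A finite list phi_0, ..., phi_N is encoded as a family indexed by nat of
   which only the terms of index at most N are used. *)
Definition generalized_moment_sequence (R : realType) (G : zmodType) (N : nat)
    (phi : nat -> G -> R[i]) : Prop :=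
  phi 0%N 0 = 1 /\
  forall k : nat, (k <= N)%N -> forall x y : G,
    phi k (x + y) =
      \sum_(j < k.+1) ('C(k, j))%:R * phi j x * phi (k - j)%N y.

(* Main.v *)
(* Put F_x(X) = \sum_(n <= N) phi_n(x) / n! X^n.  The hypothesis says that
   F_(x_1 + ... + x_l) = F_(x_1) ... F_(x_l) modulo X^(N+1).  Taking all but
   one argument equal to 0 gives F_x (1 - F_0^(l-1)) = 0.  If phi_0(0) = 0, the
   second factor is invertible modulo X^(N+1), so F_x = 0.  If phi_0(0) = 1,
   then for x = 0 the cofactor of 1 - F_0, that is
   F_0 (1 + F_0 + ... + F_0^(l-2)), has constant term l - 1 <> 0, so F_0 = 1;
   taking all but two arguments equal to 0 then gives F_(x+y) = F_x F_y. *)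
Require Import Defs.
From mathcomp Require Import all_boot all_order all_algebra.
From mathcomp Require Import reals.
From mathcomp Require Import complex.

Set Implicit Arguments.
Unset Strict Implicit.
Unset Printing Implicit Defensive.

Import GRing.Theory.

Local Open Scope ring_scope.

Section PolyModXn.
Variable F : fieldType.
Implicit Types p q d : {poly F}.

Lemma dvdXnP n p :
  reflect (forall i, (i < n)%N -> p`_i = 0) ('X^n %| p).
Proof.
apply: (iffP idP) => [/dvdpP[q ->] i ltin | p0]; first by rewrite coefMXn ltin.
apply/dvdpP; exists (drop_poly n p); rewrite -[LHS](poly_take_drop n).
suff -> : take_poly n p = 0 by rewrite add0r.
by apply/polyP => i; rewrite coef_take_poly coef0; case: ifP => // /p0.
Qed.

(** Through Gauss's lemma this cancels a factor with nonzero constant term modulo ['X^n], with no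
    need to construct its inverse. *)
Lemma coprimeXn n p : p`_0 != 0 -> coprimep 'X^n p.
Proof.
move=> p0; apply: coprimep_expl.
by rewrite coprimep_sym coprimepX /root horner_coef0.
Qed.

Lemma dvdp_subM d p1 p2 q1 q2 :
  d %| p1 - q1 -> d %| p2 - q2 -> d %| p1 * p2 - q1 * q2.
Proof.
move=> d1 d2.
have -> : p1 * p2 - q1 * q2 = (p1 - q1) * p2 + q1 * (p2 - q2).
  by rewrite mulrBl mulrBr addrA subrK.
by apply: dvdp_add; [apply: dvdp_mulr | apply: dvdp_mull].
Qed.

(** Modulo ['X^(n.+1)] each factor may be cut off after degree [n]. The product of these finite sums
    expands over all choices [k] of exponents, and only those with sum [n] reach the coefficient of
    degree [n]. *)
Lemma coef_prod_ffun (I : finType) (p : I -> {poly F}) n :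
  (\prod_t p t)`_n =
    \sum_(k : {ffun I -> 'I_n.+1} | (\sum_t k t)%N == n) \prod_t (p t)`_(k t).
Proof.
have : 'X^(n.+1) %| \prod_t p t - \prod_t \sum_(i < n.+1) (p t)`_i *: 'X^i.
  apply: (big_ind2 (fun a b : {poly F} => 'X^(n.+1) %| a - b)) => [|*|t _].
  - by rewrite subrr dvdp0.
  - exact: dvdp_subM.
  apply/dvdXnP => i ltin.
  by rewrite -(poly_def _ (fun i => (p t)`_i)) coefB coef_poly ltin subrr.
move=> /dvdXnP /(_ n (ltnSn n)) /eqP; rewrite coefB subr_eq0 => /eqP ->.
rewrite bigA_distr_bigA coef_sum [RHS]big_mkcond; apply: eq_bigr => k _ /=.
rewrite scaler_prod prodrXr coefZ coefXn eq_sym.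
by case: eqP; rewrite ?mulr1 ?mulr0.
Qed.

End PolyModXn.

Section MomentEGF.
Import Num.Theory.
Variables (F : numFieldType) (G : zmodType) (N : nat) (phi : nat -> G -> F).

Definition moment_egf (x : G) : {poly F} := \poly_(n < N.+1) (phi n x / n`!%:R).

Let fact_neq0 n : (n`!)%:R != 0 :> F.
Proof. by rewrite pnatr_eq0 -lt0n fact_gt0. Qed.

Lemma coef_moment_egf n x : (n <= N)%N -> (moment_egf x)`_n = phi n x / n`!%:R.
Proof. by rewrite coef_poly ltnS => ->. Qed.

Lemma moment_egf_coef0 x : (moment_egf x)`_0 = phi 0%N x.
Proof. by rewrite coef_moment_egf // fact0 divr1. Qed.

Lemma moment_of_coef n x y : (n <= N)%N ->
  (moment_egf x)`_n = y -> phi n x = n`!%:R * y.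
Proof. by move=> leN <-; rewrite coef_moment_egf // mulrC divfK. Qed.

(** Dividing by [n]![turns each multinomial coefficient into the product of the]1 / (k t)[!], which
    are the weights in the coefficients of the factors. *)
Lemma moment_egf_sum l :
  (forall n, (n <= N)%N -> forall x : 'I_l -> G,
    phi n (\sum_(t < l) x t) =
      \sum_(k : {ffun 'I_l -> 'I_n.+1} | (\sum_(t < l) k t)%N == n)
        multinomial F k * \prod_(t < l) phi (k t) (x t)) ->
  forall x : 'I_l -> G,
  'X^(N.+1) %| moment_egf (\sum_(t < l) x t) - \prod_(t < l) moment_egf (x t).
Proof.
move=> hphi x; apply/dvdXnP => n leN.
rewrite coefB coef_moment_egf // hphi // coef_prod_ffun mulr_suml.
apply/eqP; rewrite subr_eq0; apply/eqP; apply: eq_bigr => k _.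
under [RHS]eq_bigr => t _.
  (* Since [k t <= n <= N], no coefficient used here is lost to the truncation at [N]. *)
  rewrite coef_moment_egf; last by rewrite -ltnS (leq_trans (ltn_ord _)).
  over.
rewrite big_split /= prodfV /multinomial.
by rewrite mulrC mulrA mulrA mulVf // mul1r mulrC.
Qed.

Variable l : nat.
Hypothesis egf_sum : forall x : 'I_l.+2 -> G,
  'X^(N.+1) %| moment_egf (\sum_t x t) - \prod_t moment_egf (x t).

Lemma moment_egf_add x y :
  'X^(N.+1) %| moment_egf (x + y)
             - moment_egf x * (moment_egf y * moment_egf 0 ^+ l).
Proof.
(* The default value of [nth] puts 0 in the remaining [l] of the [l.+2] places. *)
have := egf_sum (fun t => nth 0 [:: x; y] t).
rewrite !big_ord_recl /= big1 ?addr0; last by case=> i //=; rewrite nth_nil.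
under eq_bigr do rewrite nth_nil.
by rewrite prodr_const card_ord.
Qed.

Lemma moment_egf_fix x :
  'X^(N.+1) %| (1 - moment_egf 0 ^+ l.+1) * moment_egf x.
Proof.
have := moment_egf_add x 0.
by rewrite addr0 -exprS mulrBl mul1r [_ ^+ _ * _]mulrC.
Qed.

Lemma moment_zero : phi 0%N 0 = 0 ->
  forall n, (n <= N)%N -> forall x, phi n x = 0.
Proof.
move=> phi0 n leN x.
rewrite -(mulr0 n`!%:R); apply: moment_of_coef => //.
move: (moment_egf_fix x); rewrite Gauss_dvdpr; first by move/dvdXnP; apply.
apply: coprimeXn.
by rewrite coefB coef1 exprS coef0M moment_egf_coef0 phi0 mul0r subr0 oner_neq0.
Qed.

Lemma moment_egf0 : phi 0%N 0 = 1 -> 'X^(N.+1) %| moment_egf 0 - 1.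
Proof.
move=> phi0; have := moment_egf_fix 0.
(* Up to sign the multiple is [moment_egf 0 - 1] times a cofactor with constant term [l.+1], nonzero
   in characteristic 0. *)
rewrite -dvdpNr -mulNr opprB subrX1 -mulrA Gauss_dvdpl //.
have egf00 : (moment_egf 0)`_0 = 1 by rewrite moment_egf_coef0.
apply: coprimeXn; rewrite coef0M egf00 mulr1 coef_sum.
under eq_bigr do rewrite -horner_coef0 horner_exp horner_coef0 egf00 expr1n.
by rewrite sumr_const card_ord pnatr_eq0.
Qed.

Lemma moment_egfD : phi 0%N 0 = 1 -> forall x y,
  'X^(N.+1) %| moment_egf (x + y) - moment_egf x * moment_egf y.
Proof.
move=> phi0 x y.
(* Adding F_x F_y (F_0^l - 1) removes the surplus F_0^l; this term is a multiple of F_0 - 1. *)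
have := dvdp_add (moment_egf_add x y)
  (dvdp_mull (moment_egf x * moment_egf y) _).
move=> /(_ (moment_egf 0 ^+ l - 1)).
rewrite mulrBr mulr1 mulrA addrA subrK; apply.
by rewrite subrX1 dvdp_mulr // moment_egf0.
Qed.

Lemma moment_binomial : phi 0%N 0 = 1 -> forall k, (k <= N)%N -> forall x y,
  phi k (x + y) = \sum_(j < k.+1) ('C(k, j))%:R * phi j x * phi (k - j)%N y.
Proof.
move=> phi0 k leN x y.
have /dvdXnP/(_ k leN)/eqP := moment_egfD phi0 x y.
rewrite coefB subr_eq0 => /eqP/(moment_of_coef leN) ->.
rewrite coefM mulr_sumr; apply: eq_bigr => j _.
have lejk : (j <= k)%N by rewrite -ltnS.
rewrite !coef_moment_egf ?(leq_trans lejk) ?(leq_trans (leq_subr _ _)) //.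
rewrite [X in _ * X]mulrACA -invfM -natrM -(bin_fact lejk) natrM -!mulrA.
by congr (_ * _); rewrite mulrC !mulrA divfK // natrM mulf_neq0.
Qed.

End MomentEGF.

Theorem proposition1 (R : realType) (G : zmodType) (l N : nat)
    (hl : (2 <= l)%N) (hN : (0 < N)%N)
    (phi : nat -> G -> R[i])
    (hphi : forall n : nat, (n <= N)%N -> forall x : 'I_l -> G,
      phi n (\sum_(t < l) x t) =
        \sum_(k : {ffun 'I_l -> 'I_n.+1} | (\sum_(t < l) k t)%N == n)
          multinomial R[i] k * \prod_(t < l) phi (k t) (x t)) :
  (phi 0%N 0 = 0 -> forall n : nat, (n <= N)%N -> forall x : G, phi n x = 0) /\
  (phi 0%N 0 = 1 -> generalized_moment_sequence N phi).
Proof.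
(* From here on [l] denotes the number of arguments minus 2. *)
case: l hl hphi => [|[|l]] // _ /moment_egf_sum egf_sum.
split=> [|phi0]; first exact: moment_zero egf_sum.
by split=> //; apply: moment_binomial egf_sum phi0.
Qed.
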